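(* There is a randomized distributed algorithm in the CONGEST model that, on any weighted $n$-node network $(G,w)$, solves the all-pairs shortest paths problem with approximation ratio $1+o(1)$, i.e., at termination, for every pair of nodes $u,v$, both $u$ and $v$ know a value $\widetilde{d}(u,v)$ with $\mathrm{dist}_{G,w}(u,v)\le\widetilde{d}(u,v)\le(1+o(1))\,\mathrm{dist}_{G,w}(u,v)$; it finishes in $\tilde O(n)$ rounds with high probability.
   Context: CONGEST model: the network is a connected undirected graph $G$ with $n$ nodes; nodes have unique IDs in $\{1,\dots,\mathrm{poly}(n)\}$ and unbounded local computation; initially each node knows only its ID, the IDs of its neighbours and the weights of its incident edges. In each synchronous round every node may send a message of $O(\log n)$ bits along each incident edge. Running time is the number of rounds. Edge weights $w:E(G)\to\{1,\dots,\mathrm{poly}(n)\}$ are symmetric; $\mathrm{dist}_{G,w}(u,v)$ is the minimum total weight of a $u$-$v$ path. ''With high probability'' means with probability at least $1-1/n^c$ for an arbitrary constant $c$; $\tilde O(\cdot)$ hides $\mathrm{poly}\log n$ factors. *)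

(* Defs.v *)
From mathcomp Require Import all_boot all_order all_algebra.

Set Implicit Arguments.
Unset Strict Implicit.
Unset Printing Implicit Defensive.

Import Order.TTheory GRing.Theory Num.Theory.

(* Asymptotics in the number n of nodes. *)

Definition poly_bounded (f : nat -> nat) : Prop :=
  exists C k : nat, forall n, 0 < n -> f n <= C * n ^ k.

(* T = O~(f). The case n = 1 is excluded only because log 1 = 0; the integer
   part of log_2 is within a constant factor of log for all n >= 2. *)
Definition soft_O (f T : nat -> nat) : Prop :=
  exists C k : nat, forall n, 1 < n -> T n <= C * f n * trunc_log 2 n ^ k.

Definition vanishing (eps : nat -> rat) : Prop :=
  forall e : rat, (0 < e)%R ->
    exists N, forall n, N <= n -> (`|eps n| < e)%R.

(* Weighted networks. *)

Record network (V : finType) := Network {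
  adj : rel V;
  adj_sym : symmetric adj;
  adj_irr : irreflexive adj;
  adj_connected : forall u v, connect adj u v;
  nodes_gt0 : 0 < #|V|;
  id_of : V -> nat;
  id_inj : injective id_of;
  id_gt0 : forall v, 0 < id_of v;
  wt : V -> V -> nat;
  wt_sym : forall u v, adj u v -> wt u v = wt v u;
  wt_gt0 : forall u v, adj u v -> 0 < wt u v
}.

Definition within_bounds (idmax wmax : nat -> nat) (V : finType)
    (G : network V) : Prop :=
  (forall v, id_of G v <= idmax #|V|) /\
  (forall u v, adj G u v -> wt G u v <= wmax #|V|).

(* Here u :: p is the sequence of nodes visited, as in [path]. *)
Fixpoint walk_weight (V : finType) (G : network V) (u : V) (p : seq V) : nat :=
  if p is v :: p' then wt G u v + walk_weight G v p' else 0.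

(* d = dist_{G,w}(u,v). Allowing repeated nodes does not change the minimum,
   as weights are positive. *)
Definition is_dist (V : finType) (G : network V) (u v : V) (d : nat) : Prop :=
  (exists p, [/\ path (adj G) u p, last u p = v & walk_weight G u p = d]) /\
  (forall p, path (adj G) u p -> last u p = v -> d <= walk_weight G u p).

(* Randomized distributed algorithms. *)

Definition bits := seq bool.

(* One pair (neighbour ID, edge weight) per incident edge. The list is sorted
   by ID so that its order carries no further information; in particular n is
   not part of the initial knowledge. *)
Record local_input := LocalInput {
  own_id : nat;
  incident : seq (nat * nat)
}.

Definition input_of (V : finType) (G : network V) (v : V) : local_input :=
  LocalInput (id_of G v)
    (sort (fun x y => x.1 <= y.1)
       [seq (id_of G u, wt G v u) | u <- enum V & adj G v u]).

(* All nodes run the same code. In each round a node in state s privately flips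
   [coins s] fair coins. From s and the outcome it determines the message for
   the neighbour with a given ID (None: nothing is sent), and then its next
   state, using also the messages received, indexed by the ID of their sender.
   A node has terminated once [output] is [Some f]; f then maps the ID of a
   node to the value output for that node. *)
Record algorithm := Algorithm {
  state : Type;
  init : local_input -> state;
  coins : state -> nat;
  send : state -> bits -> nat -> option bits;
  receive : state -> bits -> (nat -> option bits) -> state;
  output : state -> option (nat -> rat)
}.

Section Execution.

Variables (A : algorithm) (V : finType) (G : network V).

Definition config := V -> state A.

Definition init_config : config := fun v => init A (input_of G v).

Definition halted (c : config) (v : V) : bool := isSome (output (c v)).

Definition all_halted (c : config) : bool := [forall v, halted c v].

(* The outcomes of all the coins flipped in one round. *)
Definition toss (c : config) := {dffun forall v : V, (coins (c v)).-tuple bool}.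

Definition message (c : config) (r : toss c) (v u : V) : option bits :=
  if adj G v u && ~~ halted c v then send (c v) (r v) (id_of G u) else None.

Definition inbox (c : config) (r : toss c) (v : V) (i : nat) : option bits :=
  if [pick u | id_of G u == i] is Some u then message r u v else None.

(* Terminated nodes are frozen, and by [message] also silent. *)
Definition step (c : config) (r : toss c) : config :=
  fun v => if halted c v then c v else receive (c v) (r v) (inbox r v).

Inductive reachable : config -> Prop :=
| reach_init : reachable init_config
| reach_step c (r : toss c) : reachable c -> reachable (step r).

(* Probability that all nodes have terminated after t rounds started in c. The
   coins of different nodes and rounds are independent, so this is the average
   over the equally likely outcomes of the first round. *)
Fixpoint prob_halted (t : nat) (c : config) : rat :=
  if t is t'.+1 then
    ((\sum_(r : toss c) prob_halted t' (step r)) / #|{: toss c}|%:R)%R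
  else ((all_halted c)%:R)%R.

Definition respects_bandwidth (B : nat) : Prop :=
  forall c (r : toss c) (v u : V) (m : bits), reachable c ->
    message r v u = Some m -> size m <= B * trunc_log 2 #|V|.

(* u and v know the same value x, which lies between dist(u,v) and
   a * dist(u,v). *)
Definition solves_APSP (a : rat) (c : config) : Prop :=
  forall u v : V, exists (fu fv : nat -> rat) (x : rat) (d : nat),
    [/\ output (c u) = Some fu /\ output (c v) = Some fv,
        fu (id_of G v) = x /\ fv (id_of G u) = x,
        is_dist G u v d
      & (d%:R <= x <= a * d%:R)%R].

Definition correct (a : rat) : Prop :=
  forall c, reachable c -> all_halted c -> solves_APSP a c.

Definition finishes_with_prob (t : nat) (p : rat) : Prop :=
  (p <= prob_halted t init_config)%R.

End Execution.

(* Main.v *)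
Require Import Defs.
From mathcomp Require Import all_boot all_order all_algebra.
From mathcomp Require Import zify ring.

(* The algorithm is deterministic.

   In a first phase every node forwards the IDs it knows, one per round, in the
   order of their arrival. If an ID x has not been forwarded by u after t
   rounds, then u has been idle in at most dist(u,x) (unweighted) of them; as the
   nodes on a path from u to the first ID unknown to u are known to u, a node
   with an incomplete list knows at least t/2 IDs. Hence "t > 2 * number of known
   IDs" is a sound test of completeness, and it becomes true at all nodes in the
   same round 2n+1: the nodes learn n and are synchronised.

   In the second phase, with q = log n + 1, there is one window of R = O(nq)
   rounds for each of O(log n) scales j, in which the edge lengths are
   floor(w n q / 2^j) + 1. For a pair at distance about 2^j the scaled distance is
   at most the horizon 2nq + n, and since a shortest path has fewer than n edges,
   rounding costs a factor 1 + 1/q only. In a window a node broadcasts its current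
   estimate of the distance to i in the round that is the sum of that estimate and
   of its position in the sorted list of estimates. Along a shortest path this
   sum strictly increases, so every estimate is exact before it is due. *)

Set Implicit Arguments.
Unset Strict Implicit.
Unset Printing Implicit Defensive.

Import Order.TTheory GRing.Theory Num.Theory.

(** * Walks and distances *)

Section Walks.

Variables (V : finType) (G : network V).

Fixpoint walk_length (l : V -> V -> nat) (u : V) (p : seq V) : nat :=
  if p is v :: p' then l u v + walk_length l v p' else 0.

Lemma walk_weightE u p : walk_weight G u p = walk_length (wt G) u p.
Proof. by elim: p u => //= v p IH u; rewrite IH. Qed.

Lemma walk_length_cat l u p q :
  walk_length l u (p ++ q) = walk_length l u p + walk_length l (last u p) q.
Proof. by elim: p u => //= v p IH u; rewrite IH addnA. Qed.

Lemma reverse_walk (l : V -> V -> nat) u p :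
  (forall u v, adj G u v -> l u v = l v u) -> path (adj G) u p ->
  exists q, [/\ path (adj G) (last u p) q, last (last u p) q = u
              & walk_length l (last u p) q = walk_length l u p].
Proof.
move=> lC; elim: p u => [|v p IH] u /=; first by exists [::].
case/andP=> uv /IH [q [pq lq wq]]; exists (rcons q u).
rewrite rcons_path pq lq adj_sym uv last_rcons -cats1 walk_length_cat wq lq /=.
by split=> //; rewrite (lC u v uv) addn0 addnC.
Qed.

(** The tail is made simple first; if [u] occurs on it, the part before that occurrence is cut
    off. *)
Lemma simple_walk (l : V -> V -> nat) u p :
  path (adj G) u p ->
  exists q, [/\ path (adj G) u q, last u q = last u p, uniq (u :: q)
              & walk_length l u q <= walk_length l u p].
Proof.
elim: p u => [|v p IH] u /=; first by exists [::].
case/andP=> uv /IH [q [pq lq uq wq]]; have [uinq|uninq] := boolP (u \in v :: q).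
  case/splitPl: uinq pq lq uq wq => a b au; rewrite cat_path last_cat au.
  case/andP=> _ pb lb uq wq; exists b; split=> //.
    move: uq; rewrite -cat_cons cat_uniq => /and3P [_ /hasPn nb ub].
    rewrite /= ub andbT; apply/negP => /nb; rewrite -au.
    by rewrite mem_last.
  by move: wq; rewrite walk_length_cat au; lia.
exists (v :: q); split=> /=; rewrite ?uv ?pq ?leq_add2l //.
by rewrite uninq.
Qed.

Section Distance.

Variable l : V -> V -> nat.
Hypothesis l_gt0 : forall u v, adj G u v -> 0 < l u v.

(* Positive lengths bound the number of edges of a walk by its length, which
   makes the existence of a walk of a given length decidable. *)
Definition has_walk u v d :=
  [exists k : 'I_d.+1, exists p : k.-tuple V,
    [&& path (adj G) u p, last u p == v & walk_length l u p == d]].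

Lemma has_walkP u v d :
  reflect (exists p, [/\ path (adj G) u p, last u p = v & walk_length l u p = d])
          (has_walk u v d).
Proof.
apply: (iffP existsP) => [[k /existsP [p /and3P [pp /eqP lp /eqP wp]]]|].
  by exists p.
case=> p [pp lp wp]; have szp : size p < d.+1.
  rewrite ltnS -wp {wp lp}; elim: p u pp => //= v' p IH u /andP [uv /IH].
  by have := l_gt0 uv; lia.
exists (Ordinal szp); apply/existsP; exists (in_tuple p) => /=.
by rewrite pp lp wp !eqxx.
Qed.

Lemma has_walk_ex u v : exists d, has_walk u v d.
Proof.
have /connectP [p pp lp] := adj_connected G u v.
by exists (walk_length l u p); apply/has_walkP; exists p.
Qed.

Definition wdist u v := ex_minn (has_walk_ex u v).

Lemma wdist_walk u v :
  exists p, [/\ path (adj G) u p, last u p = v & walk_length l u p = wdist u v].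
Proof. by apply/has_walkP; rewrite /wdist; case: ex_minnP. Qed.

Lemma wdist_le u p :
  path (adj G) u p -> wdist u (last u p) <= walk_length l u p.
Proof.
move=> pp; rewrite /wdist; case: ex_minnP => d _; apply.
by apply/has_walkP; exists p.
Qed.

Lemma wdist_refl u : wdist u u = 0.
Proof. by apply/eqP; rewrite -leqn0; apply: (@wdist_le u [::]). Qed.

Lemma wdist_edge u v x : adj G u v -> wdist u x <= l u v + wdist v x.
Proof.
move=> uv; have [p [pp lp wp]] := wdist_walk v x.
by rewrite -wp -lp; apply: (@wdist_le u (v :: p)); rewrite /= uv.
Qed.

Lemma wdist_first u x : u != x ->
  exists2 v, adj G u v & wdist u x = l u v + wdist v x.
Proof.
have [[|v p] [/= pp lp wp]] := wdist_walk u x; first by rewrite lp eqxx.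
move=> _; case/andP: pp => uv pp; exists v => //; apply/eqP.
rewrite eqn_leq wdist_edge //= -wp leq_add2l -lp.
exact: wdist_le.
Qed.

Lemma wdist_gt0 u x : u != x -> 0 < wdist u x.
Proof. by case/wdist_first=> v uv ->; rewrite addn_gt0 l_gt0. Qed.

Lemma wdist_sym u v :
  (forall u v, adj G u v -> l u v = l v u) -> wdist u v = wdist v u.
Proof.
move=> lC; suff le x y : wdist x y <= wdist y x.
  by apply/eqP; rewrite eqn_leq !le.
have [p [pp lp wp]] := wdist_walk y x.
have [q [pq lq wq]] := reverse_walk lC pp.
by rewrite -wp -wq -lp -{2}lq; apply: wdist_le.
Qed.

(** The bound on the number of edges limits the total rounding error, which is at most one unit per
    edge. *)
Lemma wdist_simple u v :
  exists p, [/\ path (adj G) u p, last u p = v, size p < #|V|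
              & walk_length l u p = wdist u v].
Proof.
have [p [pp lp wp]] := wdist_walk u v.
have [q [pq lq uq wq]] := simple_walk l pp; exists q; split=> //.
- by rewrite lq.
- by rewrite -[_.+1]/(size (u :: q)) -(card_uniqP uq) max_card.
- apply/eqP; rewrite eqn_leq -wp wq wp /= -lp -lq; exact: wdist_le.
Qed.

End Distance.

Lemma is_dist_wdist u v : is_dist G u v (wdist (@wt_gt0 _ G) u v).
Proof.
split=> [|p pp lp]; last by rewrite walk_weightE -lp wdist_le.
have [p [pp lp wp]] := wdist_walk (@wt_gt0 _ G) u v.
by exists p; rewrite walk_weightE.
Qed.

End Walks.

(** * Encoding of numbers and polynomial bounds *)

Definition enc (N : nat) : bits :=
  [seq odd (N %/ 2 ^ i) | i <- iota 0 (trunc_log 2 N).+1].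

Definition dec (m : bits) : nat := foldr (fun (b : bool) a => b + a.*2) 0 m.

Arguments enc : simpl never.
Arguments dec : simpl never.

Lemma size_enc N : size (enc N) = (trunc_log 2 N).+1.
Proof. by rewrite size_map size_iota. Qed.

Lemma encK : cancel enc dec.
Proof.
move=> N; rewrite /enc.
suff H k : forall M, M < 2 ^ k ->
    dec [seq odd (M %/ 2 ^ i) | i <- iota 0 k] = M.
  by apply: H; apply: trunc_log_ltn.
elim: k => [|k IH] M; first by rewrite expn0 ltnS leqn0 => /eqP ->.
rewrite expnS /= => ltM; rewrite divn1 (iotaDl 1 0 k) -map_comp.
rewrite -[RHS]odd_double_half; congr (_ + _.*2); rewrite -[RHS]IH; last first.
  by rewrite -divn2 ltn_divLR // mulnC.
congr dec; apply: eq_map => i /=; rewrite add1n expnS divnMA -divn2 //.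
Qed.

Lemma poly_bounded_id : poly_bounded id.
Proof. by exists 1, 1 => n _; rewrite mul1n expn1. Qed.

Lemma poly_bounded_cst c : poly_bounded (fun=> c).
Proof. by exists c, 0 => n _; rewrite muln1. Qed.

Lemma poly_boundedM f g :
  poly_bounded f -> poly_bounded g -> poly_bounded (fun n => f n * g n).
Proof.
move=> [C [k Hf]] [D [m Hg]]; exists (C * D), (k + m) => n n0.
by rewrite expnD mulnACA leq_mul ?Hf ?Hg.
Qed.

Lemma poly_boundedD f g :
  poly_bounded f -> poly_bounded g -> poly_bounded (fun n => f n + g n).
Proof.
move=> [C [k Hf]] [D [m Hg]]; exists (C + D), (k + m) => n n0.
rewrite mulnDl leq_add //.
  by rewrite (leq_trans (Hf n n0)) // leq_mul2l leq_pexp2l ?leq_addr ?orbT.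
by rewrite (leq_trans (Hg n n0)) // leq_mul2l leq_pexp2l ?leq_addl ?orbT.
Qed.

Lemma trunc_log_poly f : poly_bounded f ->
  exists B, forall n N, 1 < n -> N <= f n ->
    (trunc_log 2 N).+1 <= B * trunc_log 2 n.
Proof.
move=> [C [k Hf]]; exists (C + k * 2).+1 => n N n1 leN.
have l0 : 0 < trunc_log 2 n by rewrite trunc_log_gt0.
set L := trunc_log 2 n in l0 *.
have [->|N0] := posnP N; first by rewrite trunc_log0; nia.
suff : trunc_log 2 N <= (C + k * 2) * L by rewrite mulSn; lia.
rewrite -(leq_exp2l _ _ (isT : 1 < 2)).
apply: leq_trans (trunc_logP _ N0) _ => //.
apply: leq_trans (leq_trans leN (Hf n (ltnW n1))) _.
(* [n < 2 ^ L.+1], and [L.+1 <= 2 * L] because [L] is positive. *)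
have nle : n <= 2 ^ (2 * L).
  apply: leq_trans (ltnW (trunc_log_ltn n (isT : 1 < 2))) _.
  by rewrite leq_exp2l // -/L; lia.
rewrite mulnDl expnD leq_mul //.
  by rewrite (leq_trans (ltnW (ltn_expl C (isT : 1 < 2)))) // leq_exp2l //; nia.
by rewrite -mulnA mulnC expnM; case: (k) => [//|k']; rewrite leq_exp2r.
Qed.

(** * The algorithm *)

(** Ties between equal estimates are broken by ID, which makes this a strict total order. *)
Definition before (e : nat -> nat) (i j : nat) : bool :=
  (e i < e j) || (e i == e j) && (i < j).

Definition position (e : nat -> nat) (K : seq nat) (i : nat) : nat :=
  count (fun j => before e j i) K.

Definition due (e : nat -> nat) (K : seq nat) (r : nat) : option nat :=
  ohead [seq i <- K | e i + position e K i == r].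

(** The position strictly increases, as [i] itself is counted for [j] but not for [i], while [e]
    does not decrease. Hence distinct IDs are due in distinct rounds, and one broadcast per round
    suffices. *)
Lemma before_position e K i j :
  i \in K -> before e i j -> e i + position e K i < e j + position e K j.
Proof.
move=> iK ij; rewrite -addnS leq_add //.
  by case/orP: ij => [/ltnW //|/andP [/eqP -> _]].
rewrite /position; elim: K iK => //= k K IH.
have tr h : before e h i -> before e h j by rewrite /before in ij *; lia.
rewrite inE => /orP [/eqP <-|/IH lt].
  have -> : before e i i = false by rewrite /before ltnn ltnn andbF.
  by rewrite ij /= add0n add1n ltnS; apply: sub_count.
by have := tr k; case: (before e k i); case: (before e k j) => //=; lia.
Qed.

Lemma due_sound e K r i : due e K r = Some i -> i \in K /\ e i + position e K i = r.
Proof.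
rewrite /due; case E : [seq _ <- K | _] => [|j s] //= [<-].
have : j \in [seq i <- K | e i + position e K i == r] by rewrite E mem_head.
by rewrite mem_filter => /andP [/eqP].
Qed.

Lemma due_complete e K i : i \in K -> due e K (e i + position e K i) = Some i.
Proof.
move=> iK; case E : (due e K _) => [j|]; last first.
  move: E; rewrite /due; case E : [seq _ <- K | _] => [|j s] // _.
  have : i \in [seq j <- K | e j + position e K j == e i + position e K i].
    by rewrite mem_filter eqxx.
  by rewrite E.
have [jK ej] := due_sound E; congr Some; apply/eqP; apply: contraT => neq.
have [/(before_position jK)|/(before_position iK)] : before e j i \/ before e i j.
  by rewrite /before; case: (ltngtP (e i) (e j)); case: (ltngtP i j) neq => //=;
    auto; lia.
all: by rewrite ej ltnn.
Qed.

(* [clk] counts the rounds, [ptr] the known IDs already forwarded; an entry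
   ((j, i), d) of [log] is an upper bound d, received from a neighbour, for the
   distance to i at scale j. *)
Record node := Node {
  inp : local_input;
  clk : nat;
  known : seq nat;
  ptr : nat;
  log : seq ((nat * nat) * nat)
}.

Section Algorithm.

Variable wmax : nat -> nat.

Definition precision n := (trunc_log 2 n).+1.
Definition horizon n := 2 * n * precision n + n.
(** Positions are below [n], so an ID whose estimate is within the horizon falls due inside the
    window. *)
Definition window n := horizon n + n.
(** [n * wmax n] bounds every distance, so each positive distance lies between [2 ^ j] and
    [2 ^ j.+1] for some scale [j]. *)
Definition scales n := (trunc_log 2 (n * wmax n)).+1.
Definition deadline n := (2 * n).+1 + scales n * window n.

(** The successor rounds up, so scaled distances never underestimate; it also keeps all lengths
    positive. *)
Definition scaled n j w := ((w * n * precision n) %/ 2 ^ j).+1.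

(* The length of a window stands for an infinite distance. *)
Definition est (s : node) (j i : nat) : nat :=
  foldr (fun o a => if o.1 == (j, i) then minn o.2 a else a)
    (if i == own_id (inp s) then 0 else window (size (known s))) (log s).

Definition flooding s := clk s <= 2 * size (known s).
Definition ltime s := clk s - (2 * size (known s)).+1.
Definition scale s := ltime s %/ window (size (known s)).
Definition lround s := ltime s %% window (size (known s)).

Definition node_init (x : local_input) := Node x 0 [:: own_id x] 0 [::].

(** In the second phase an ID and an estimate are packed into one number in base [window]; an
    estimate that is due is a valid digit, being at most the current round of the window. *)
Definition node_send (s : node) : option bits :=
  if flooding s then
    if ptr s < size (known s) then Some (enc (nth 0 (known s) (ptr s))) else None
  else
    omap (fun i => enc (i * window (size (known s)) + est s (scale s) i))
      (due (est s (scale s)) (known s) (lround s)).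

Definition news (s : node) (box : nat -> option bits) : seq nat :=
  undup (pmap (fun a => omap dec (box a.1)) (incident (inp s))).

Definition offer (s : node) (box : nat -> option bits) (a : nat * nat) :=
  omap (fun m => let R := window (size (known s)) in
      ((scale s, dec m %/ R),
        scaled (size (known s)) (scale s) a.2 + dec m %% R))
    (box a.1).

Definition node_receive (s : node) (box : nat -> option bits) : node :=
  if flooding s then
    Node (inp s) (clk s).+1
      (known s ++ [seq i <- news s box | i \notin known s])
      (* The cap is the old length, so an ID received in this round does not yet count as
         forwarded. *)
      (minn (ptr s).+1 (size (known s))) [::]
  else
    Node (inp s) (clk s).+1 (known s) (ptr s)
      (pmap (offer s box) (incident (inp s)) ++ log s).

(** The least suitable scale has the finest rounding; the estimate is converted back to the original
    units. *)
Definition answer (s : node) (i : nat) : rat :=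
  let n := size (known s) in
  let j := find (fun j => est s j i <= horizon n) (iota 0 (scales n)) in
  ((2 ^ j * est s j i)%:R / (n * precision n)%:R)%R.

Definition node_output (s : node) : option (nat -> rat) :=
  if clk s < deadline (size (known s)) then None else Some (answer s).

Definition apsp : algorithm :=
  @Algorithm node node_init (fun=> 0) (fun s _ _ => node_send s)
    (fun s _ box => node_receive s box) node_output.

(** * Deterministic execution *)

Section Run.

Variables (V : finType) (G : network V).

Definition node_inbox (c : V -> node) (v : V) (i : nat) : option bits :=
  if [pick u | id_of G u == i] is Some u then
    if adj G u v && ~~ isSome (node_output (c u)) then node_send (c u) else None
  else None.

Definition next_round (c : V -> node) (v : V) : node :=
  if isSome (node_output (c v)) then c v else node_receive (c v) (node_inbox c v).

Definition run t : V -> node := iter t next_round (init_config apsp G).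

Lemma step_next_round (c : config apsp V) (r : toss c) : step G r = next_round c.
Proof. by []. Qed.

Lemma reachable_run (c : config apsp V) : reachable G c -> exists t, c = run t.
Proof.
elim=> [|c' r _ [t ->]]; first by exists 0.
by exists t.+1; rewrite step_next_round.
Qed.

Lemma prob_halted_run (k t : nat) :
  all_halted (A := apsp) (run (k + t)) ->
  prob_halted G k (run t : config apsp V) = 1%R.
Proof.
elim: k t => [|k IH] t hk; first by rewrite /= (hk : all_halted _).
have one (r : toss (run t : config apsp V)) : prob_halted G k (step G r) = 1%R.
  by rewrite step_next_round; apply: (IH t.+1); rewrite addnS.
rewrite /= (eq_bigr _ (fun r _ => one r)).
(* This is the average of a constant; the set of outcomes must be nonempty for the division. *)
rewrite sumr_const divff // pnatr_eq0 -lt0n.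
apply/card_gt0P.
by exists [ffun v => nseq_tuple (coins ((run t : config apsp V) v)) true].
Qed.

End Run.
End Algorithm.

(** * Flooding of the IDs *)

Section Flood.

Variables (wmax : nat -> nat) (V : finType) (G : network V).

Notation n := #|V|.
Notation ID := (id_of G).
Notation run := (run wmax G).
Notation next_round := (next_round wmax G).
Notation output := (node_output wmax).

Definition ids := [seq ID u | u <- enum V].

Lemma size_ids : size ids = n.
Proof. by rewrite size_map cardE. Qed.

Lemma ids_uniq : uniq ids.
Proof. by rewrite map_inj_uniq ?enum_uniq //; apply: id_inj. Qed.

Lemma mem_ids v : ID v \in ids.
Proof. by rewrite map_f ?mem_enum. Qed.

Lemma idsP i : reflect (exists v, i = ID v) (i \in ids).
Proof.
by apply: (iffP mapP) => [[v _ ->]|[v ->]]; exists v; rewrite ?mem_enum.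
Qed.

Lemma incidentP v (a : nat * nat) :
  reflect (exists2 u, adj G v u & a = (ID u, wt G v u))
          (a \in incident (input_of G v)).
Proof.
rewrite mem_sort; apply: (iffP mapP) => [[u]|[u vu ->]].
  by rewrite mem_filter => /andP [vu _] ->; exists u.
by exists u => //; rewrite mem_filter vu mem_enum.
Qed.

Lemma node_inboxE c v u : adj G v u ->
  node_inbox wmax G c v (ID u) =
    if isSome (output (c u)) then None else node_send (c u).
Proof.
move=> vu; rewrite /node_inbox; case: pickP => [x /eqP /id_inj ->|/(_ u)].
  by rewrite adj_sym vu; case: (isSome _).
by rewrite eqxx.
Qed.

Record flood_inv t (c : V -> node) : Prop := FloodInv {
  flood_clk : forall v, clk (c v) = t;
  flood_inp : forall v, inp (c v) = input_of G v;
  flood_log : forall v, log (c v) = [::];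
  flood_uniq : forall v, uniq (known (c v));
  flood_own : forall v, ID v \in known (c v);
  flood_sub : forall v, {subset known (c v) <= ids};
  flood_ptr : forall v, ptr (c v) <= size (known (c v));
  flood_sent : forall u v, adj G u v ->
    {subset take (ptr (c u)) (known (c u)) <= known (c v)};
  (* A node can have been idle only while IDs were still on their way to it, so
     an ID that it has not forwarded delays it by at most its distance. *)
  flood_delay : forall u p, path (adj G) u p ->
    ID (last u p) \notin take (ptr (c u)) (known (c u)) -> t <= ptr (c u) + size p
}.

Lemma flood_size t c v : flood_inv t c -> size (known (c v)) <= n.
Proof.
move=> I; rewrite -size_ids uniq_leq_size ?(flood_uniq I) //.
exact: flood_sub I v.
Qed.

(** On a simple path from [v] to an unknown node, let [k] be the index of the first unknown ID. The
    [k] IDs before it are distinct and known, so [k <= size (known (c v))], while [flood_delay] on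
    the prefix of length [k] gives [t <= ptr (c v) + k]. *)
Lemma flood_complete t c v : flood_inv t c -> 2 * size (known (c v)) < t ->
  forall x, ID x \in known (c v).
Proof.
move=> I lt x; apply: contraTT lt => xK; rewrite -leqNgt.
have /connectP [p0 pp0 lp0] := adj_connected G v x; move: pp0 lp0.
case/shortenP => p pp up _ lx {p0}.
pose unk y := ID y \notin known (c v).
have hasu : has unk (v :: p) by apply/hasP; exists x; rewrite // lx mem_last.
have := nth_find v hasu; have := hasu; rewrite has_find.
have := @before_find _ v unk (v :: p).
set k := find _ _ => kmin kp kunk.
have k0 : 0 < k.
  by case: (k) kunk => //=; rewrite /unk (flood_own I).
have lastk : last v (take k p) = nth v (v :: p) k.
  case: (k) k0 kp => // k' _; rewrite /= ltnS => kp.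
  by rewrite -(nth_last v) size_takel // nth_take.
have szk : size (take k p) = k by rewrite size_takel.
have lek : k <= size (known (c v)).
  have <- : size (take k (v :: p)) = k by rewrite size_takel // ltnW.
  rewrite -(size_map ID); apply: uniq_leq_size.
    by rewrite map_inj_uniq ?take_uniq //; apply: id_inj.
  move=> i /mapP [y /(nthP v) [m]]; rewrite size_takel; last exact: ltnW.
  move=> mk.
  by rewrite nth_take // => <- ->; apply/negPn; rewrite -/(unk _) kmin.
have := flood_delay I (@take_path _ _ _ _ k pp); rewrite lastk szk.
have nin : ID (nth v (v :: p) k) \notin take (ptr (c v)) (known (c v)).
  by apply: contra kunk; apply: mem_take.
by move/(_ nin); have := flood_ptr I v; lia.
Qed.

(** A node past its flooding phase would know all [n] IDs, hence [2 * n < t]. *)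
Lemma flood_flooding t c v : flood_inv t c -> t <= 2 * n -> flooding (c v).
Proof.
move=> I le; rewrite /flooding (flood_clk I) leqNgt; apply: contraL le => lt.
rewrite -ltnNge; apply: (leq_trans _ lt); rewrite ltnS leq_mul2l -size_ids /=.
apply: uniq_leq_size ids_uniq _ => _ /idsP [x ->]; exact: flood_complete lt x.
Qed.

Lemma flood_running t c v : flood_inv t c -> t <= 2 * n -> output (c v) = None.
Proof.
move=> I le; rewrite /node_output; case: ltnP => //.
have := flood_flooding v I le; rewrite /flooding /deadline; lia.
Qed.

Lemma flood_init : flood_inv 0 (init_config (apsp wmax) G).
Proof.
split=> //= v; rewrite ?inE //.
- by move=> i; rewrite inE => /eqP ->; apply: mem_ids.
Qed.

Lemma flood_step t c : flood_inv t c -> t <= 2 * n -> flood_inv t.+1 (next_round c).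
Proof.
move=> I le.
have nx v : next_round c v =
    Node (inp (c v)) (clk (c v)).+1
      (known (c v) ++
        [seq i <- news (c v) (node_inbox wmax G c v) | i \notin known (c v)])
      (minn (ptr (c v)).+1 (size (known (c v)))) [::].
  by rewrite /next_round (flood_running v I le) /node_receive (flood_flooding v I le).
have send u : node_send (c u) =
    if ptr (c u) < size (known (c u)) then
      Some (enc (nth 0 (known (c u)) (ptr (c u)))) else None.
  by rewrite /node_send (flood_flooding u I le).
have newsP v i : i \in news (c v) (node_inbox wmax G c v) <->
    exists u, [/\ adj G v u, ptr (c u) < size (known (c u))
                & i = nth 0 (known (c u)) (ptr (c u))].
  rewrite /news (flood_inp I) mem_undup mem_pmap; split.
    case/mapP => a /incidentP [u vu ->] /=; rewrite node_inboxE //.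
    rewrite (flood_running u I le) send /=; case: ltnP => //= lt [->].
    by exists u; rewrite encK.
  case=> u [vu lt ->]; apply/mapP; exists (ID u, wt G v u).
    by apply/incidentP; exists u.
  by rewrite /= node_inboxE // (flood_running u I le) send lt /= encK.
(* The list grows only at its end, so the forwarded prefix gains just the entry at [ptr], if there
   is one. *)
have take_next u : take (ptr (next_round c u)) (known (next_round c u)) =
    take (ptr (c u)).+1 (known (c u)).
  rewrite nx /= take_cat; set k := size _; case: ltnP => h.
    by congr take; lia.
  have -> : minn (ptr (c u)).+1 k - k = 0 by lia.
  by rewrite take0 cats0 take_oversize //; lia.
have takeS u i : (i \in take (ptr (c u)).+1 (known (c u))) =
    (i \in take (ptr (c u)) (known (c u))) ||
    (ptr (c u) < size (known (c u))) && (i == nth 0 (known (c u)) (ptr (c u))).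
  case: ltnP => h; first by rewrite (take_nth 0 h) mem_rcons inE orbC.
  by rewrite !take_oversize ?orbF //; lia.
split=> [v|v|v|v|v|v i|v|u v uv i|u p pp].
- by rewrite nx /= (flood_clk I).
- by rewrite nx /= (flood_inp I).
- by rewrite nx.
- rewrite nx /= cat_uniq (flood_uniq I) filter_uniq ?undup_uniq // andbT.
  by apply/hasPn => i; rewrite mem_filter => /andP [].
- by rewrite nx /= mem_cat (flood_own I).
- rewrite nx /= mem_cat mem_filter => /orP [/(flood_sub I) //|/andP [_ /newsP]].
  by case=> u [_ lt ->]; apply: (flood_sub I (v := u)); apply: mem_nth.
- by rewrite nx /= size_cat; lia.
- rewrite take_next takeS nx /= mem_cat mem_filter => /orP [/(flood_sent I uv) ->//|].
  case/andP=> lt /eqP e; case: (boolP (i \in known (c v))) => //= _.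
  by apply/newsP; exists u; rewrite adj_sym.
- rewrite take_next takeS negb_or => /andP [nin nx'].
  have [lt|ge] := ltnP (ptr (c u)) (size (known (c u))).
    by have := flood_delay I pp nin; rewrite nx /=; lia.
  (* An idle [u] has forwarded all it knows. The next node [v] on the path cannot have forwarded the
     missing ID, and all that [v] has forwarded is known to [u]; so the bound for [v] and the
     shorter path yields the one for [u]. *)
  have eqp : ptr (c u) = size (known (c u)).
    by apply/eqP; rewrite eqn_leq ge (flood_ptr I).
  have unk : ID (last u p) \notin known (c u).
    by move: nin; rewrite eqp take_size.
  case: p pp nin unk {nx'} => [|v p] /=.
    by move=> _ _; rewrite (flood_own I).
  case/andP => uv pp nin unk; have vu : adj G v u by rewrite adj_sym.
  have := flood_delay I pp (contra (flood_sent I vu (x := _)) unk).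
  have : ptr (c v) <= size (known (c u)).
    rewrite -(size_takel (flood_ptr I v)); apply: uniq_leq_size.
      by rewrite take_uniq // (flood_uniq I).
    exact: flood_sent I v u vu.
  by rewrite nx /= eqp; lia.
Qed.

Lemma run_flood t : t <= (2 * n).+1 -> flood_inv t (run t).
Proof.
elim: t => [|t IH] le; first exact: flood_init.
by apply: flood_step; first exact/IH/ltnW.
Qed.

End Flood.

(** * Distances at one scale *)

Section Fold.

Variables (j i : nat).

Let f (o : (nat * nat) * nat) a := if o.1 == (j, i) then minn o.2 a else a.

Lemma fold_min_le a s : foldr f a s <= a.
Proof.
by elim: s => //= o s IH; rewrite /f; case: ifP => _; rewrite ?geq_min ?IH ?orbT.
Qed.

Lemma fold_min_mem a s d : ((j, i), d) \in s -> foldr f a s <= d.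
Proof.
elim: s => //= o s IH; rewrite inE => /orP [/eqP <-|/IH le].
  by rewrite /f eqxx geq_minl.
by rewrite /f; case: ifP => _ //; rewrite geq_min le orbT.
Qed.

Lemma fold_min_ge a s b :
  b <= a -> (forall d, ((j, i), d) \in s -> b <= d) -> b <= foldr f a s.
Proof.
move=> ba; elim: s => //= o s IH H.
have {IH} le := IH (fun d ds => H d (@mem_behead _ (o :: s) _ ds)).
rewrite /f; case: eqP => // eo; rewrite leq_min le andbT H //.
by rewrite -eo -surjective_pairing mem_head.
Qed.

End Fold.

Section Relax.

Variables (wmax : nat -> nat) (V : finType) (G : network V).

Notation n := #|V|.
Notation R := (window n).
Notation ID := (id_of G).
Notation ids := (ids G).
Notation run := (run wmax G).
Notation next_round := (next_round wmax G).
Notation output := (node_output wmax).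

Lemma window_gt0 : 0 < R.
Proof. by rewrite /window addn_gt0 (nodes_gt0 G) orbT. Qed.

Definition scaled_wt j u v := scaled n j (wt G u v).

Lemma scaled_wt_gt0 j u v : adj G u v -> 0 < scaled_wt j u v. Proof. by []. Qed.

Definition sdist j := wdist (@scaled_wt_gt0 j).

Definition sdist_id j u i :=
  if [pick x | ID x == i] is Some x then sdist j u x else 0.

Lemma sdist_idE j u x : sdist_id j u (ID x) = sdist j u x.
Proof.
by rewrite /sdist_id; case: pickP => [y /eqP /id_inj ->|/(_ x)]; rewrite ?eqxx.
Qed.

(** The position of [x] in the list of [u] if all estimates were exact; [sdist j u x + rank j u x]
    is then the round of window [j] in which [u] broadcasts its distance to [x]. *)
Definition rank j u x := position (sdist_id j u) ids (ID x).

Lemma rank_lt j u x : rank j u x < n.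
Proof.
rewrite /rank /position -(size_ids G).
rewrite -(count_predC (fun i => before (sdist_id j u) i (ID x))).
rewrite -addn1 leq_add2l -has_count; apply/hasP; exists (ID x); first exact: mem_ids.
by rewrite /= /before ltnn ltnn andbF.
Qed.

(* Along the first edge of a shortest path all distances grow by at most the
   length of that edge. *)
Lemma rank_first j u v x : adj G v u ->
  sdist j v x = scaled_wt j v u + sdist j u x ->
  rank j u x <= rank j v x.
Proof.
move=> vu dx; rewrite /rank /position /ids !count_map; apply: sub_count => y /=.
rewrite /before !sdist_idE dx.
by have := wdist_edge (@scaled_wt_gt0 j) y vu; rewrite -/(sdist j); lia.
Qed.

(** [minn R (tau - j * R)] counts the completed rounds of window [j]; truncated subtraction makes it
    [0] before that window. In [relax_ge] the minimum with [R] reflects that [R] stands for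
    infinity. *)
Record relax_inv tau (c : V -> node) : Prop := RelaxInv {
  relax_clk : forall v, clk (c v) = (2 * n).+1 + tau;
  relax_inp : forall v, inp (c v) = input_of G v;
  relax_known : forall v, perm_eq (known (c v)) ids;
  relax_own : forall j v, est (c v) j (ID v) = 0;
  relax_ge : forall j v x, minn R (sdist j v x) <= est (c v) j (ID x);
  relax_le : forall j u v x, adj G v u ->
    sdist j u x + rank j u x < minn R (tau - j * R) ->
    est (c v) j (ID x) <= scaled_wt j v u + sdist j u x
}.

Lemma relax_size tau c v : relax_inv tau c -> size (known (c v)) = n.
Proof. by move=> I; rewrite (perm_size (relax_known I v)) size_ids. Qed.

(** By [rank_first], the next node [u] on a shortest path was due strictly earlier than [v], so
    [relax_le] gives the upper bound. *)
Lemma relax_est tau c j v x : relax_inv tau c ->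
  sdist j v x + rank j v x <= minn R (tau - j * R) ->
  est (c v) j (ID x) = sdist j v x.
Proof.
move=> I le; have [->|neq] := eqVneq v x.
  by rewrite (relax_own I) /sdist wdist_refl.
have [u vu du] := wdist_first (@scaled_wt_gt0 j) neq.
have := rank_first vu du; have := @scaled_wt_gt0 j _ _ vu.
rewrite -/(sdist j) in du *.
have := relax_le I (j := j) (x := x) vu; have := relax_ge I j v x; lia.
Qed.

(** An inexact estimate is never too small below [R], so what precedes [x] by estimate does so by
    distance. Conversely, what precedes [x] by distance is due earlier, hence already exact. *)
Lemma relax_position tau c j u x : relax_inv tau c ->
  sdist j u x + rank j u x <= minn R (tau - j * R) ->
  sdist j u x + rank j u x < R ->
  position (est (c u) j) (known (c u)) (ID x) = rank j u x.
Proof.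
move=> I le lt; rewrite /position (permP (relax_known I u)).
apply: eq_in_count => _ /idsP [y ->].
have ex := relax_est I le; apply/idP/idP => /= yx.
  have := relax_ge I j u y; move: yx; rewrite /before !sdist_idE ex; lia.
have := before_position (mem_ids G y) yx; rewrite !sdist_idE -!/(rank _ _ _) => ltp.
have ey : est (c u) j (ID y) = sdist j u y by apply: relax_est I _; lia.
by move: yx; rewrite /before !sdist_idE ex ey.
Qed.

Lemma relax_start : relax_inv 0 (run (2 * n).+1).
Proof.
have I := run_flood wmax G (leqnn _).
have lt v : 2 * size (known (run (2 * n).+1 v)) < (2 * n).+1.
  by rewrite ltnS leq_mul2l (flood_size v I) orbT.
have perm v : perm_eq (known (run (2 * n).+1 v)) ids.
  rewrite uniq_perm ?(flood_uniq I) ?ids_uniq // => i; apply/idP/idP.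
    exact: (flood_sub I (v := v)).
  by case/idsP=> x ->; exact: flood_complete I (lt v) x.
have estE j v x : est (run (2 * n).+1 v) j (ID x) = if v == x then 0 else R.
  rewrite /est (flood_log I) (flood_inp I) /= (perm_size (perm v)) size_ids.
  by rewrite (inj_eq (@id_inj _ G)) eq_sym.
split=> [v|v|v|j v|j v x|j u v x _].
- by rewrite (flood_clk I) addn0.
- exact: flood_inp I v.
- exact: perm.
- by rewrite estE eqxx.
- rewrite estE; case: eqP => [->|_]; last exact: geq_minl.
  by rewrite /sdist wdist_refl; lia.
- by rewrite sub0n minn0.
Qed.

Lemma relax_running tau c v : relax_inv tau c -> tau < scales wmax n * R ->
  output (c v) = None.
Proof.
move=> I lt; rewrite /node_output (relax_size v I) (relax_clk I) /deadline.
by rewrite ltn_add2l lt.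
Qed.

Lemma relax_send tau c u : relax_inv tau c ->
  node_send (c u) =
    omap (fun i => enc (i * R + est (c u) (tau %/ R) i))
      (due (est (c u) (tau %/ R)) (known (c u)) (tau %% R)).
Proof.
move=> I; rewrite /node_send /flooding /scale /lround /ltime (relax_size u I).
by rewrite (relax_clk I) leqNgt ltnS leq_addr /= addnC addnK.
Qed.

Lemma relax_offer tau c v u : relax_inv tau c -> tau < scales wmax n * R ->
  adj G v u ->
  offer (c v) (node_inbox wmax G c v) (ID u, wt G v u) =
    omap (fun i =>
        ((tau %/ R, i), scaled_wt (tau %/ R) v u + est (c u) (tau %/ R) i))
      (due (est (c u) (tau %/ R)) (known (c u)) (tau %% R)).
Proof.
move=> I lt vu; rewrite /offer /= node_inboxE // (relax_running u I lt).
rewrite (relax_send u I); case E : (due _ _ _) => [i|] //=.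
have [_ er] := due_sound E; have := ltn_pmod tau window_gt0; rewrite -er => ltR.
have eR : est (c u) (tau %/ R) i < R by lia.
rewrite /scale /ltime (relax_size v I) (relax_clk I) addnC addnK encK.
by rewrite (divnMDl _ _ window_gt0) (divn_small eR) addn0 modnMDl (modn_small eR).
Qed.

Lemma relax_step tau c : relax_inv tau c -> tau < scales wmax n * R ->
  relax_inv tau.+1 (next_round c).
Proof.
move=> I lt; set J := tau %/ R; set r := tau %% R.
pose offers v := pmap (offer (c v) (node_inbox wmax G c v)) (incident (inp (c v))).
have nx v : next_round c v =
    Node (inp (c v)) (clk (c v)).+1 (known (c v)) (ptr (c v))
      (offers v ++ log (c v)).
  rewrite /next_round (relax_running v I lt) /node_receive /flooding.
  by rewrite (relax_size v I) (relax_clk I) leqNgt ltnS leq_addr.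
have estE v j i : est (next_round c v) j i =
    foldr (fun o a => if o.1 == (j, i) then minn o.2 a else a)
      (est (c v) j i) (offers v) by rewrite nx /est /= foldr_cat.
have offersP v o : o \in offers v <-> exists u i, [/\ adj G v u,
    due (est (c u) J) (known (c u)) r = Some i
    & o = ((J, i), scaled_wt J v u + est (c u) J i)].
  rewrite /offers mem_pmap (relax_inp I); split.
    case/mapP=> a /incidentP [u vu ->]; rewrite (relax_offer I lt vu) -/J -/r.
    by case E : (due _ _ _) => [i|] //= [->]; exists u, i.
  case=> u [i [vu E ->]]; apply/mapP; exists (ID u, wt G v u).
    by apply/incidentP; exists u.
  by rewrite (relax_offer I lt vu) -/J -/r E.
have ltr : r < R by rewrite ltn_pmod ?window_gt0.
have tauE : tau = J * R + r := divn_eq tau R.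
split=> [v|v|v|j v|j v x|j u v x vu].
- by rewrite nx /= (relax_clk I) addnS.
- by rewrite nx /= (relax_inp I).
- by rewrite nx /= (relax_known I).
- by apply/eqP; rewrite -leqn0 estE -[X in _ <= X](relax_own I j v) fold_min_le.
(* By the triangle inequality no offer undercuts the distance. *)
- rewrite estE; apply: fold_min_ge; first exact: (relax_ge I).
  move=> d /offersP [u [i [vu E [-> ei ->]]]].
  have := wdist_edge (@scaled_wt_gt0 J) x vu; rewrite -/(sdist J) -ei.
  by have := relax_ge I J u x; lia.
(* For [j] other than the current window, the count of completed rounds stays at [R] or at [0]. *)
- rewrite estE; have [->|neqj] := eqVneq j J; last first.
    move=> ltd; apply: leq_trans (fold_min_le _ _ _ _) (relax_le I vu _).
    apply: leq_trans ltd _; have [lj|gj] := ltnP j J.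
      have : j.+1 * R <= J * R by rewrite leq_mul2r lj orbT.
      by rewrite mulSn; lia.
    have : J.+1 * R <= j * R by rewrite leq_mul2r [J < j]ltn_neqAle [J == j]eq_sym neqj gj orbT.
    by rewrite mulSn; lia.
  have -> : minn R (tau.+1 - J * R) = r.+1 by lia.
  (* The only new obligation concerns an ID due exactly in round [r]; its estimate at [u] is exact
     and is broadcast now. *)
  rewrite ltnS leq_eqVlt => /orP [/eqP er|ltd]; last first.
    apply: leq_trans (fold_min_le _ _ _ _) (relax_le I vu _).
    by apply: leq_trans ltd _; lia.
  have le : sdist J u x + rank J u x <= minn R (tau - J * R) by lia.
  have eu := relax_est I le; apply: fold_min_mem; apply/offersP.
  exists u, (ID x); rewrite eu; split=> //.
  rewrite -er -(relax_position I le) ?er // -eu; apply: due_complete.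
  by rewrite (perm_mem (relax_known I u)) mem_ids.
Qed.

End Relax.

(** * Correctness and running time *)

Section Output.

Variables (wmax : nat -> nat) (V : finType) (G : network V).

Notation n := #|V|.
Notation R := (window n).
Notation ID := (id_of G).
Notation T := (deadline wmax n).
Notation run := (run wmax G).
Notation output := (node_output wmax).
Notation dist := (wdist (@wt_gt0 _ G)).

Lemma run_relax tau : tau <= scales wmax n * R ->
  relax_inv G tau (run ((2 * n).+1 + tau)).
Proof.
elim: tau => [|tau IH] le; first by rewrite addn0; apply: relax_start.
by rewrite addnS; apply: (relax_step (wmax := wmax)) => //; apply/IH/ltnW.
Qed.

Lemma run_deadline : relax_inv G (scales wmax n * R) (run T).
Proof. exact: run_relax. Qed.

Lemma deadline_output v : output (run T v) = Some (answer wmax (run T v)).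
Proof.
rewrite /node_output (relax_size v run_deadline) (relax_clk run_deadline).
by rewrite ltnn.
Qed.

Lemma run_after k v : run (k + T) v = run T v.
Proof.
by elim: k => //= k IH; rewrite /next_round -/(run _) IH deadline_output.
Qed.

Lemma run_before t v : t < T -> output (run t v) = None.
Proof.
move=> lt; have [le|gt] := leqP t (2 * n).
  exact: flood_running (run_flood wmax G (leqW le)) le.
have tE : t = (2 * n).+1 + (t - (2 * n).+1) by rewrite subnKC.
rewrite /deadline in lt; rewrite tE.
by apply: relax_running (run_relax _) _; lia.
Qed.

Lemma run_halted t v : isSome (output (run t v)) -> run t v = run T v.
Proof.
have [le|lt] := leqP T t; last by rewrite run_before.
by rewrite -(subnK le) run_after.
Qed.

Lemma all_halted_deadline : all_halted (A := apsp wmax) (run T).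
Proof. by apply/forallP => v; rewrite /halted /= deadline_output. Qed.

Lemma deadline_est j v x : j < scales wmax n -> sdist G j v x <= horizon n ->
  est (run T v) j (ID x) = sdist G j v x.
Proof.
move=> lt le; apply: relax_est run_deadline _.
have : j.+1 * R <= scales wmax n * R by rewrite leq_mul2r lt orbT.
by have := rank_lt G j v x; rewrite /window; nia.
Qed.

(** Nodes can thus recognise reliable estimates: one within the horizon is below [R], hence no less
    than the scaled distance. *)
Lemma deadline_ge j v x :
  j < scales wmax n ->
  (est (run T v) j (ID x) <= horizon n) = (sdist G j v x <= horizon n).
Proof.
move=> lt; apply/idP/idP => le; last by rewrite deadline_est.
have := relax_ge run_deadline j v x; have := nodes_gt0 G; rewrite /window; lia.
Qed.

(** Each edge is rounded up by at most one unit, which is worth [2 ^ j] after scaling back. *)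
Lemma scaled_walk j u p :
  walk_length (wt G) u p * (n * precision n)
    <= walk_length (scaled_wt G j) u p * 2 ^ j
    <= walk_length (wt G) u p * (n * precision n) + size p * 2 ^ j.
Proof.
elim: p u => //= v p IH u; have := IH v; rewrite !mulnDl mulSn.
have e0 : 0 < 2 ^ j by rewrite expn_gt0.
have -> : scaled_wt G j u v = ((wt G u v * n * precision n) %/ 2 ^ j).+1 by [].
rewrite mulSn -mulnA; set x := wt G u v * _.
by have := divn_eq x (2 ^ j); have := ltn_pmod x e0; lia.
Qed.

Lemma sdist_ge j u v : dist u v * (n * precision n) <= sdist G j u v * 2 ^ j.
Proof.
have [p [pp lp wp]] := wdist_walk (@scaled_wt_gt0 _ G j) u v.
rewrite /sdist -wp; have /andP [le _] := scaled_walk j u p; apply: leq_trans le.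
by rewrite leq_mul2r -lp wdist_le ?orbT.
Qed.

Lemma sdist_le j u v :
  sdist G j u v * 2 ^ j <= dist u v * (n * precision n) + n * 2 ^ j.
Proof.
have [p [pp lp sp wp]] := wdist_simple (@wt_gt0 _ G) u v.
rewrite -wp; have /andP [_ le] := scaled_walk j u p.
apply: leq_trans (leq_trans _ le) _; last by rewrite leq_add2l leq_mul2r ltnW ?orbT.
by rewrite leq_mul2r -lp wdist_le ?orbT.
Qed.

Hypothesis wmaxP : forall u v, adj G u v -> wt G u v <= wmax n.

Lemma dist_le u v : dist u v <= n * wmax n.
Proof.
have [p [pp lp sp <-]] := wdist_simple (@wt_gt0 _ G) u v.
apply: (@leq_trans (size p * wmax n)); last by rewrite leq_mul2r ltnW ?orbT.
elim: p u pp {lp sp} => //= x p IH u /andP [ux /IH le].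
by rewrite mulSn leq_add ?wmaxP.
Qed.

Definition level u v :=
  find (fun j => sdist G j u v <= horizon n) (iota 0 (scales wmax n)).

(* At the scale of the distance, its scaled version is within the horizon. *)
Lemma levelP u v : 0 < dist u v ->
  [/\ level u v < scales wmax n, sdist G (level u v) u v <= horizon n
    & 2 ^ level u v <= dist u v].
Proof.
move=> d0; set P := fun j => sdist G j u v <= horizon n.
set k := trunc_log 2 (dist u v).
have klt : k < scales wmax n by rewrite ltnS leq_trunc_log // dist_le.
have kd : 2 ^ k <= dist u v by apply: trunc_logP.
have dk : dist u v < 2 ^ k.+1 by apply: trunc_log_ltn.
have Pk : P k.
  rewrite /P -(leq_pmul2r (expn_gt0 2 k)).
  apply: leq_trans (sdist_le k u v) _; rewrite /horizon mulnDl leq_add2r.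
  (* The factor 2 in [horizon] comes from bounding the distance by [2 ^ k.+1]. *)
  apply: (@leq_trans (2 ^ k.+1 * (n * precision n))).
    by rewrite leq_mul2r ltnW ?orbT.
  by rewrite expnS; nia.
have hP : has P (iota 0 (scales wmax n)).
  by apply/hasP; exists k; rewrite // mem_iota.
have lvl : level u v < scales wmax n by move: hP; rewrite has_find size_iota.
split=> //; first by have := nth_find 0 hP; rewrite nth_iota.
(* The first suitable scale may be smaller than [k], but by minimality it is not larger. *)
apply: leq_trans kd; rewrite leq_exp2l // leqNgt; apply/negP => lt.
by have := before_find 0 lt; rewrite nth_iota // add0n -/(P k) Pk.
Qed.

Lemma answerE u v : u != v -> answer wmax (run T u) (ID v) =
  ((2 ^ level u v * sdist G (level u v) u v)%:R / (n * precision n)%:R)%R.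
Proof.
move=> uv; have d0 : 0 < dist u v by apply: wdist_gt0.
have [lvl le _] := levelP d0.
rewrite /answer (relax_size u run_deadline).
have -> : find (fun j => est (run T u) j (ID v) <= horizon n)
              (iota 0 (scales wmax n)) = level u v.
  by apply: eq_in_find => j; rewrite mem_iota => /andP [_ lt]; apply: deadline_ge.
by rewrite deadline_est.
Qed.

Lemma answer_self u : answer wmax (run T u) (ID u) = 0%R.
Proof. by rewrite /answer (relax_own run_deadline) muln0 mul0r. Qed.

(** Both endpoints select the same scale, as needed for them to output the same value. *)
Lemma level_sym u v : level u v = level v u.
Proof.
apply: eq_find => j; congr (_ <= _); apply: wdist_sym => x y xy.
by rewrite /scaled_wt (wt_sym xy).
Qed.

Lemma sdist_sym j u v : sdist G j u v = sdist G j v u.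
Proof. by apply: wdist_sym => x y xy; rewrite /scaled_wt (wt_sym xy). Qed.

(** The rounding error is at most [n * 2 ^ level u v] in units of [1 / (n * precision n)], and
    [2 ^ level u v] is at most the distance. *)
Lemma answer_bounds u v :
  ((dist u v)%:R <= answer wmax (run T u) (ID v)
     <= (1 + 1 / (precision n)%:R) * (dist u v)%:R)%R.
Proof.
have [->|uv] := eqVneq u v.
  by rewrite answer_self wdist_refl mulr0 lexx.
have d0 : 0 < dist u v by apply: wdist_gt0.
have [_ _ le] := levelP d0.
have q0 : (0 < (precision n)%:R :> rat)%R by rewrite ltr0n.
have nq0 : (0 < (n * precision n)%:R :> rat)%R by rewrite ltr0n muln_gt0 (nodes_gt0 G).
rewrite answerE // ler_pdivlMr // ler_pdivrMr // -natrM ler_nat.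
rewrite [2 ^ _ * _]mulnC sdist_ge /=.
have -> : ((1 + 1 / (precision n)%:R) * (dist u v)%:R * (n * precision n)%:R
           = (dist u v * (n * precision n) + n * dist u v)%:R :> rat)%R.
  rewrite natrD !natrM; field; exact: lt0r_neq0.
rewrite ler_nat; apply: leq_trans (sdist_le _ _ _) _.
by rewrite leq_add2l leq_mul2l le orbT.
Qed.

Lemma apsp_correct : correct (apsp wmax) G (1 + 1 / (precision n)%:R)%R.
Proof.
move=> c /(reachable_run (wmax := wmax)) [t ->] /forallP hlt u v.
have outE x : output (run t x) = Some (answer wmax (run T x)).
  by rewrite (run_halted (hlt x)) deadline_output.
exists (answer wmax (run T u)), (answer wmax (run T v)).
exists (answer wmax (run T u) (ID v)), (dist u v); split.
- by split; apply: outE.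
- split=> //; have [->//|uv] := eqVneq u v.
  by rewrite (answerE uv) answerE ?[v == u]eq_sym // level_sym sdist_sym.
- exact: is_dist_wdist.
- exact: answer_bounds.
Qed.

(** A flooding message is an ID; a later one encodes an ID times [R] plus an estimate below [R]. *)
Lemma message_le (c : config (apsp wmax) V) (r : toss c) v u m idmax :
  (forall x, ID x <= idmax) -> reachable G c -> message G r v u = Some m ->
  exists2 N, m = enc N & N <= (idmax + 1) * R.
Proof.
move=> idP /(reachable_run (wmax := wmax)) [t ct]; subst c.
rewrite /message; case: ifP => // /andP [_ run_v].
have lt : t < T.
  rewrite ltnNge; apply/negP => le; move: run_v.
  by rewrite /halted /= -(subnK le) run_after deadline_output.
have R0 := window_gt0 G; rewrite [send _ _ _]/(node_send (run t v)).
have [le|gt] := leqP t (2 * n).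
  have I := run_flood wmax G (leqW le).
  rewrite (flood_flooding v I le); case: ltnP => // ltp [<-].
  eexists; first by [].
  have /idsP [x ->] := flood_sub I (mem_nth 0 ltp).
  by have := idP x; nia.
have tE : t = (2 * n).+1 + (t - (2 * n).+1) by rewrite subnKC.
have I : relax_inv G (t - (2 * n).+1) (run t).
  by rewrite {2}tE; apply: run_relax; rewrite /deadline in lt; lia.
rewrite -[if _ then _ else _]/(node_send (run t v)) (relax_send v I).
case E : (due _ _ _) => [i|] //= [<-].
eexists; first by [].
have [iK er] := due_sound E.
have := ltn_pmod (t - (2 * n).+1) R0; rewrite -er.
have /idsP [x ->] : i \in ids G by rewrite -(perm_mem (relax_known I v)).
rewrite mulnDl mul1n => ltR; rewrite leq_add ?leq_mul2r ?idP ?orbT //.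
exact: leq_trans (leq_addr _ _) (ltnW ltR).
Qed.

(** The probability is 1, so the same deadline serves every exponent [k]. *)
Lemma apsp_finishes k : finishes_with_prob (apsp wmax) G T (1 - 1 / n%:R ^+ k)%R.
Proof.
have := @prob_halted_run wmax V G T 0; rewrite addn0 /finishes_with_prob => ->.
  by rewrite gerBl divr_ge0 ?exprn_ge0 ?ler0n.
exact: all_halted_deadline.
Qed.

End Output.

(** * Asymptotic bounds *)

Lemma poly_bounded_window : poly_bounded window.
Proof.
have Hp : poly_bounded precision.
  exists 2, 1 => m m0; rewrite /precision expn1.
  have := trunc_logP (isT : 1 < 2) m0.
  by have := ltn_expl (trunc_log 2 m) (isT : 1 < 2); lia.
apply: poly_boundedD poly_bounded_id; apply: poly_boundedD poly_bounded_id.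
apply: poly_boundedM Hp; apply: poly_boundedM (poly_bounded_cst 2) poly_bounded_id.
Qed.

(** With [l] the logarithm, flooding takes at most [3 * m] rounds, and there are at most [B * l]
    windows of at most [6 * m * l] rounds. *)
Lemma deadline_soft_O wmax : poly_bounded wmax -> soft_O id (deadline wmax).
Proof.
move=> hw; have [B HB] := trunc_log_poly (poly_boundedM poly_bounded_id hw).
exists (3 + B * 6), 2 => m m1; rewrite /deadline.
have l0 : 0 < trunc_log 2 m by rewrite trunc_log_gt0.
have : scales wmax m <= B * trunc_log 2 m by apply: HB.
have : window m <= 6 * m * trunc_log 2 m by rewrite /window /horizon /precision; nia.
move: (trunc_log 2 m) l0 => l l0 le1 le2.
have : scales wmax m * window m <= B * l * (6 * m * l) by apply: leq_mul.
have : (2 * m).+1 <= 3 * m * l ^ 2 by rewrite expnS expn1; nia.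
rewrite expnS expn1; lia.
Qed.

Lemma vanishing_precision : vanishing (fun n => 1 / (precision n)%:R)%R.
Proof.
(* From this threshold on, the logarithm of [n] exceeds [e^-1]. *)
move=> e e0; exists (2 ^ Num.bound e^-1) => n n_ge.
have n0 : 0 < n by apply: leq_trans n_ge; rewrite expn_gt0.
have lek : Num.bound e^-1 <= trunc_log 2 n.
  exact: trunc_log_max.
rewrite div1r ger0_norm ?invr_ge0 ?ler0n // invf_plt ?posrE ?ltr0n //.
apply: lt_le_trans (archi_boundP _) _; first by rewrite invr_ge0 ltW.
by rewrite ler_nat leqW.
Qed.

Theorem theorem1p3 (idmax wmax : nat -> nat)
    (hid : poly_bounded idmax) (hw : poly_bounded wmax) :
  exists (A : algorithm) (B : nat) (eps : nat -> rat),
    vanishing eps /\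
    (forall (V : finType) (G : network V), within_bounds idmax wmax G ->
       respects_bandwidth A G B /\ correct A G (1 + eps #|V|)%R) /\
    (forall c : nat, exists T : nat -> nat, soft_O id T /\
       forall (V : finType) (G : network V), within_bounds idmax wmax G ->
         finishes_with_prob A G (T #|V|) (1 - 1 / (#|V|%:R) ^+ c)%R).
Proof.
have [B HB] := trunc_log_poly
  (poly_boundedM (poly_boundedD hid (poly_bounded_cst 1)) poly_bounded_window).
exists (apsp wmax), B, (fun n => 1 / (precision n)%:R)%R; split; last split.
- exact: vanishing_precision.
- move=> V G [idP wP]; split; last exact: apsp_correct.
  move=> c r v u m rc msg.
  have [N -> le] := message_le idP rc msg; rewrite size_enc; apply: HB le.
  (* The logarithmic bound needs two nodes; the ends of the edge carrying the message provide
     them. *)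
  apply/card_gt1P; exists v, u; split=> //.
  move: msg; rewrite /message; case: ifP => // /andP [vu _] _.
  by apply: contraTneq vu => ->; rewrite adj_irr.
- move=> c; exists (deadline wmax); split; first exact: deadline_soft_O.
  move=> V G _; exact: apsp_finishes.
Qed.
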